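(* Let $1<\alpha\le2$ and $V(x)=k|x|^{-\alpha}$ on $\mathbf{R}^3$. For every $k>0$, the infimum $$n_k=\inf\{S_k(\varphi):\varphi\in H^1(\mathbf{R}^3)\setminus\{0\},\ P_k(\varphi)=0\}$$ is never attained; that is, there is no $\varphi\in H^1(\mathbf{R}^3)\setminus\{0\}$ with $P_k(\varphi)=0$ and $S_k(\varphi)=n_k$.
   Context: For $\varphi\in H^1(\mathbf{R}^3)$ (integrals over $\mathbf{R}^3$), $$S_k(\varphi)=\tfrac12\int|\nabla\varphi|^2dx+\tfrac12\int V|\varphi|^2dx+\tfrac12\int|\varphi|^2dx-\tfrac14\int|\varphi|^4dx,$$ $$P_k(\varphi)=2\int|\nabla\varphi|^2dx-\int(x\cdot\nabla V)|\varphi|^2dx-\tfrac32\int|\varphi|^4dx.$$ *)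

(* Defs.v *)
From HB Require Import structures.
From mathcomp Require Import all_boot all_order all_algebra.
From mathcomp Require Import complex.
From mathcomp Require Import all_classical all_reals all_analysis.

Set Implicit Arguments.
Unset Strict Implicit.
Unset Printing Implicit Defensive.

Import Order.TTheory GRing.Theory Num.Theory.
Import numFieldNormedType.Exports.

Local Open Scope classical_set_scope.
Local Open Scope ring_scope.

(* R^3 is modelled by nested pairs, so that it carries both the product
   topology and the product of the Borel sigma-algebras. The library norm on
   this type is the sup norm; the Euclidean length is [enorm] below. *)
Notation R3 R := (measurableTypeR R * measurableTypeR R * measurableTypeR R)%type.

Section Space.
Variable R : realType.

Definition leb3 : {measure set (R3 R) -> \bar R} :=
  ((@lebesgue_measure R \x @lebesgue_measure R) \x @lebesgue_measure R)%E.

Definition coord3 (i : 'I_3) (x : R3 R) : R := [:: x.1.1; x.1.2; x.2]`_i.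

Definition basis_vec (i : 'I_3) : R3 R :=
  ((i == 0%N :> nat)%:R, (i == 1%N :> nat)%:R, (i == 2%N :> nat)%:R).

Definition enorm (x : R3 R) : R := Num.sqrt (\sum_(i < 3) coord3 i x ^+ 2).

Definition partial (i : 'I_3) (f : R3 R -> R) : R3 R -> R :=
  fun x => 'D_(basis_vec i) f x.

Definition iter_partial (s : seq 'I_3) (f : R3 R -> R) : R3 R -> R :=
  foldr partial f s.

(* C^infinity: all iterated partial derivatives exist and are continuous. *)
Definition smooth (f : R3 R -> R) : Prop :=
  forall s : seq 'I_3, continuous (iter_partial s f) /\
    forall (i : 'I_3) (x : R3 R), derivable (iter_partial s f) x (basis_vec i).

Definition test_function (psi : R3 R -> R) : Prop :=
  smooth psi /\ compact (closure [set x | psi x != 0]).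

Definition is_weak_partial (i : 'I_3) (u g : R3 R -> R) : Prop :=
  forall psi : R3 R -> R, test_function psi ->
    (\int[leb3]_x (u x * partial i psi x)%:E =
     - \int[leb3]_x (g x * psi x)%:E)%E.

Definition L2 (u : R3 R -> R[i]) : Prop :=
  (fun x => complex.Re (u x)) \in Lfun leb3 2%:E /\
  (fun x => complex.Im (u x)) \in Lfun leb3 2%:E.

Definition is_weak_partialC (i : 'I_3) (u g : R3 R -> R[i]) : Prop :=
  is_weak_partial i (fun x => complex.Re (u x)) (fun x => complex.Re (g x)) /\
  is_weak_partial i (fun x => complex.Im (u x)) (fun x => complex.Im (g x)).

(* A representative of a complex-valued H^1 function, bundled with its weak
   gradient. The latter is determined almost everywhere by the former, so
   integrals involving [H1grad] depend on the function only. *)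
Record H1 := MkH1 {
  H1fun :> R3 R -> R[i] ;
  H1grad : 'I_3 -> R3 R -> R[i] ;
  H1fun_L2 : L2 H1fun ;
  H1grad_L2 : forall i, L2 (H1grad i) ;
  H1grad_weak : forall i, is_weak_partialC i H1fun (H1grad i) }.

(* phi <> 0 as an element of H^1 *)
Definition H1_neq0 (phi : H1) : Prop := ~ {ae leb3, forall x, phi x = 0}.

Definition abs2 (z : R[i]) : R := Normc.normc z ^+ 2.

Definition grad_abs2 (phi : H1) (x : R3 R) : R :=
  \sum_(i < 3) abs2 (H1grad phi i x).

Definition x_dot_grad (V : R3 R -> R) (x : R3 R) : R :=
  \sum_(i < 3) coord3 i x * partial i V x.

(* [S_functional] and [P_functional] are extended-real valued, like the Lebesgue integral of
   the library. For the inverse-power potentials below all the integrals are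
   finite on H^1 (Hardy and Sobolev inequalities). *)
Definition S_functional (V : R3 R -> R) (phi : H1) : \bar R :=
  ((1 / 2)%:E * \int[leb3]_x (grad_abs2 phi x)%:E
   + (1 / 2)%:E * \int[leb3]_x (V x * abs2 (phi x))%:E
   + (1 / 2)%:E * \int[leb3]_x (abs2 (phi x))%:E
   - (1 / 4)%:E * \int[leb3]_x (Normc.normc (phi x) ^+ 4)%:E)%E.

Definition P_functional (V : R3 R -> R) (phi : H1) : \bar R :=
  (2%:E * \int[leb3]_x (grad_abs2 phi x)%:E
   - \int[leb3]_x (x_dot_grad V x * abs2 (phi x))%:E
   - (3 / 2)%:E * \int[leb3]_x (Normc.normc (phi x) ^+ 4)%:E)%E.

(* The values of V and of its derivative at the origin are irrelevant, since
   V only occurs under integrals. *)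
Definition inv_power (k alpha : R) (x : R3 R) : R := k * enorm x `^ (- alpha).

Definition constrained_inf (V : R3 R -> R) : \bar R :=
  ereal_inf [set S_functional V phi | phi in
    [set phi : H1 | H1_neq0 phi /\ P_functional V phi = 0%E]].

End Space.

(* Main.v *)
From HB Require Import structures.
Require Import Defs.
From mathcomp Require Import all_boot all_order all_algebra.
From mathcomp Require Import complex ring lra.
From mathcomp Require Import all_classical all_reals all_analysis.
From mathcomp Require Import measurable_realfun.
Set Implicit Arguments.
Unset Strict Implicit.
Unset Printing Implicit Defensive.
Import Order.TTheory GRing.Theory Num.Theory.
Import numFieldNormedType.Exports.
Local Open Scope classical_set_scope.
Local Open Scope ring_scope.

(** A minimiser can always be improved by moving it away from the origin and
    then spreading it out.

    Write [A], [B], [M], [Q] for the integrals of the squared gradient, of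
    [V |phi|^2], of [|phi|^2] and of [|phi|^4].  By Euler's identity
    [x . grad V = - alpha V], so the constraint reads
    [2 A + alpha B = (3/2) Q].  Eliminating [A] between the constraint and the
    energy gives, on the constraint set,
      [S = Q / 8 + (2 - alpha) / 4 * B + M / 2],
    which is nondecreasing in [B] because [alpha <= 2] and increasing in [Q].

    Suppose that [phi] is a minimiser.  Translations leave [A], [M] and [Q]
    unchanged.  The average over a cube of side [rho] of the potential energies
    of the translates of [phi] is at most [65 k rho^(-alpha) M]; for large
    [rho] this is smaller than [B > 0], so some translate has potential energy
    [beta < B] (exists_small_translate).  It violates the constraint on the
    negative side, and the mass-preserving dilation by some factor [l < 1],
    under which [A], [beta], [Q] become [l^2 A], [l^alpha beta], [l^3 Q],
    restores the constraint (scaling_root).  Both [Q] and [B] have decreased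
    and [M] has not changed, so the new function has strictly smaller energy
    (energy_decrease), a contradiction.

    The rest of the work is to see that translation and dilation act on [H1]:
    the change of variables in the integrals (integral_aff), and the stability
    of test functions, hence of weak derivatives, under affine maps
    (is_weak_partial_aff).  The finiteness of [B] and [Q] comes from the
    constraint itself. *)

(** * Change of variables under a map that scales the measure *)

Section ScaledIso.
Local Open Scope ereal_scope.
Context d (T : measurableType d) (R : realType).
Implicit Types (mu : {measure set T -> \bar R}) (phi psi : T -> T).
Implicit Types (f : T -> \bar R) (a c : R).

Import HBNNSimple.

Definition scales_measure mu a phi :=
  forall A, measurable A -> mu (phi @^-1` A) = a%:E * mu A.

Lemma scales_measure_inv mu a phi psi : (0 < a)%R ->
  measurable_fun setT psi -> cancel phi psi ->
  scales_measure mu a phi -> scales_measure mu a^-1 psi.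
Proof.
move=> a0 mpsi phiK muphi A mA.
have mpA : measurable (psi @^-1` A).
  by rewrite -[X in measurable X]setTI; exact: mpsi.
have := muphi _ mpA.
rewrite -comp_preimage (_ : psi \o phi = id); last first.
  by apply/funext => x; exact: phiK.
by rewrite preimage_id => ->; rewrite muleA -EFinM mulVf ?gt_eqF// mul1e.
Qed.

(** The level sets of the left-hand side are the preimages under [phi] of the
    level sets of [h], with the levels multiplied by [c]. *)
Lemma sintegral_scaled_comp mu a c phi (h : {nnsfun T >-> R}) :
  (0 < c)%R -> scales_measure mu a phi ->
  sintegral mu (cst c \* (h \o phi))%R = (c * a)%:E * sintegral mu h.
Proof.
move=> c0 muphi; have c_neq0 : c != 0%R by rewrite gt_eqF.
rewrite !sintegralET ge0_mule_fsumr; last exact: nnsfun_mulemu_ge0.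
rewrite (reindex_fsbigT ( *%R c))/=; last first.
  by exists ( *%R c^-1); [exact: mulKf|exact: mulVKf].
apply: eq_fsbigr => x _; rewrite preimage_cstM// [(_ / c)%R]mulrC mulKf//.
rewrite comp_preimage muphi//.
by rewrite !muleA -!EFinM (mulrAC c a x).
Qed.

(** The integral is a supremum over simple functions, and composing with [phi]
    maps the simple functions below [f] to simple functions below [f \o phi].
    This argument covers arbitrary [f], in particular integrands that contain
    derivatives of a test function, whose continuity refers to the product
    topology and not to the product sigma-algebra. *)
Lemma ge0_integral_scaled_comp_le mu a c phi f :
  (0 < a)%R -> (0 < c)%R -> measurable_fun setT phi ->
  scales_measure mu a phi -> (forall x, 0 <= f x) ->
  (c * a)%:E * \int[mu]_x f x <= \int[mu]_x (c%:E * f (phi x)).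
Proof.
move=> a0 c0 mphi muphi f0; rewrite !ge0_integralTE//; last first.
  by move=> x; rewrite mule_ge0// lee_fin ltW.
rewrite -ereal_sup_pZl ?mulr_gt0//.
apply: ge_ereal_sup => _ [_ [h /= hf <-] <-].
have mg : measurable_fun setT (h \o phi) by apply: measurableT_comp.
have fg : finite_set (range (h \o phi)).
  by apply: sub_finite_set (fimfunP h) => _ [x _ <-]; exists (phi x).
have g0 (x : T) : (0 <= (h \o phi) x)%R by exact: fun_ge0.
pose g : {nnsfun T >-> R} := HB.pack (h \o phi)
  (isMeasurableFun.Build _ _ _ _ _ mg) (FiniteImage.Build _ _ _ fg)
  (isNonNegFun.Build _ _ _ g0).
rewrite -(sintegral_scaled_comp _ c0 muphi).
apply: ereal_sup_ubound => /=.
exists (scale_nnsfun g (ltW c0)) => //= x.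
by rewrite EFinM lee_pmul2l.
Qed.

Lemma ge0_integral_scaled_comp mu a c phi psi f :
  (0 < a)%R -> (0 < c)%R ->
  measurable_fun setT phi -> measurable_fun setT psi ->
  cancel phi psi -> cancel psi phi ->
  scales_measure mu a phi -> (forall x, 0 <= f x) ->
  \int[mu]_x (c%:E * f (phi x)) = (c * a)%:E * \int[mu]_x f x.
Proof.
move=> a0 c0 mphi mpsi phiK psiK muphi f0.
apply/eqP; rewrite eq_le ge0_integral_scaled_comp_le// andbT.
rewrite -lee_pdivrMl ?mulr_gt0// invfM.
have cf0 x : 0 <= c%:E * f (phi x) by rewrite mule_ge0// lee_fin ltW.
apply: le_trans (ge0_integral_scaled_comp_le _ _ mpsi
  (scales_measure_inv a0 mpsi phiK muphi) cf0) _; rewrite ?invr_gt0//.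
under eq_integral do rewrite psiK muleA -EFinM mulVf ?gt_eqF// mul1e.
by [].
Qed.

(** The positive and negative parts scale separately; the case analysis covers
    the conventions of the extended reals when one of them is infinite. *)
Lemma integral_scaled_comp mu a c phi psi f :
  (0 < a)%R -> (0 < c)%R ->
  measurable_fun setT phi -> measurable_fun setT psi ->
  cancel phi psi -> cancel psi phi -> scales_measure mu a phi ->
  \int[mu]_x (c%:E * f (phi x)) = (c * a)%:E * \int[mu]_x f x.
Proof.
move=> a0 c0 mphi mpsi phiK psiK muphi.
rewrite [LHS]integralE [in RHS]integralE.
rewrite (ge0_funeposM (f \o phi)) ?ltW// (ge0_funenegM (f \o phi)) ?ltW//.
rewrite funepos_comp funeneg_comp.
rewrite (ge0_integral_scaled_comp a0 c0 mphi mpsi phiK psiK)//.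
rewrite (ge0_integral_scaled_comp a0 c0 mphi mpsi phiK psiK)//.
have ca0 : (0 < c * a)%R by rewrite mulr_gt0.
have : 0 <= \int[mu]_x f^\+ x by apply: integral_ge0.
have : 0 <= \int[mu]_x f^\- x by apply: integral_ge0.
case: (\int[mu]_x f^\+ x) => [r||]; case: (\int[mu]_x f^\- x) => [s||] //= _ _;
  rewrite ?gt0_muley ?gt0_muleNy ?lte_fin//=.
by rewrite -!EFinM -!EFinB mulrBr.
Qed.

End ScaledIso.

(** * Lebesgue measure on R^3 under dilations and translations *)

(** Normalising the pushforward by [a] turns the scaling property of [phi] into
    an equality of measures, to which uniqueness theorems apply. *)
Definition rescaled_pushforward d (T : measurableType d) (R : realType)
    (mu : {measure set T -> \bar R}) (a : R) (a0 : 0 <= a) (phi : T -> T)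
    (mphi : measurable_fun setT phi) : {measure set T -> \bar R} :=
  mscale (NngNum a0)
    (measure_function_pushforward__canonical__measure_function_Measure mu mphi).

Section SigmaFiniteProduct.
Local Open Scope ereal_scope.
Context d1 d2 (T1 : measurableType d1) (T2 : measurableType d2) (R : realType).
Variables (m1 : {sigma_finite_measure set T1 -> \bar R}).
Variables (m2 : {sigma_finite_measure set T2 -> \bar R}).

Lemma sigma_finite_prod : sigma_finite setT (m1 \x m2).
Proof.
have /sigma_finiteP[F [TF ndF Foo]] := sigma_finiteT m1.
have /sigma_finiteP[G [TG ndG Goo]] := sigma_finiteT m2.
exists (fun n => F n `*` G n).
  apply/esym/seteqP; split => // -[x y] _ /=.
  have [n _ Fnx] : (\bigcup_n F n) x by rewrite -TF.
  have [k _ Gky] : (\bigcup_n G n) y by rewrite -TG.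
  exists (maxn n k) => //; split => /=.
    by move: x Fnx; exact/subsetPset/ndF/leq_maxl.
  by move: y Gky; exact/subsetPset/ndG/leq_maxr.
move=> k; have [mF Fk] := Foo k; have [mG Gk] := Goo k.
split; first exact: measurableX.
by rewrite product_measure1E// lte_mul_pinfty// ge0_fin_numE.
Qed.

(** An alias of the product measure, so that the sigma-finite structure can be
    attached to it and products can be iterated. *)
Definition sigma_finite_product : set (T1 * T2) -> \bar R := m1 \x m2.
HB.instance Definition _ := Measure.on sigma_finite_product.
HB.instance Definition _ :=
  Measure_isSigmaFinite.Build _ _ _ sigma_finite_product sigma_finite_prod.

End SigmaFiniteProduct.

Section ProductScaling.
Local Open Scope ereal_scope.
Context d1 d2 (T1 : measurableType d1) (T2 : measurableType d2) (R : realType).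
Variables (m1 : {sigma_finite_measure set T1 -> \bar R}).
Variables (m2 : {sigma_finite_measure set T2 -> \bar R}).
Variables (phi1 : T1 -> T1) (phi2 : T2 -> T2) (a1 a2 : R).
Hypotheses (a10 : (0 < a1)%R) (a20 : (0 < a2)%R).
Hypotheses (mphi1 : measurable_fun setT phi1).
Hypotheses (mphi2 : measurable_fun setT phi2).
Hypotheses (sphi1 : scales_measure m1 a1 phi1).
Hypotheses (sphi2 : scales_measure m2 a2 phi2).

Let phi (x : T1 * T2) := (phi1 x.1, phi2 x.2).

Lemma measurable_fun_pair_map : measurable_fun setT phi.
Proof.
by apply: measurable_fun_pair; [apply: (measurableT_comp mphi1)|
  apply: (measurableT_comp mphi2)].
Qed.

Lemma scales_measure_prod : scales_measure (m1 \x m2) (a1 * a2) phi.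
Proof.
move=> A mA.
have aa0 : (0 <= (a1 * a2)^-1)%R by rewrite invr_ge0 mulr_ge0 ?ltW.
pose m' := rescaled_pushforward (m1 \x m2) aa0 measurable_fun_pair_map.
have /= -> // := @product_measure_unique _ _ _ _ _ m1 m2 m' _ _ mA.
  rewrite /m'/= /mscale/= /pushforward/= muleA -EFinM mulfV ?mul1e//.
  by rewrite mulf_eq0 !gt_eqF.
move=> B C mB mC; rewrite /m'/= /mscale/= /pushforward/=.
rewrite (_ : _ @^-1` _ = (phi1 @^-1` B) `*` (phi2 @^-1` C)) //.
rewrite product_measure1E; last 2 first.
- by rewrite -[X in measurable X]setTI; exact: mphi1.
- by rewrite -[X in measurable X]setTI; exact: mphi2.
rewrite sphi1// sphi2// muleACA.
have E : ((a1 * a2)^-1)%:E * (a1%:E * a2%:E) = 1 :> \bar R.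
  by rewrite -!EFinM mulVf// mulf_eq0 !gt_eqF.
by rewrite [LHS]muleA E mul1e.
Qed.

End ProductScaling.

Section AffineR3.
Local Open Scope ereal_scope.
Variable R : realType.
Local Notation MR := (measurableTypeR R).
Local Notation mu := (@lebesgue_measure R).

Definition aff1 (l b : R) : MR -> MR := fun x => (l * x + b)%R.

Lemma measurable_aff1 l b : measurable_fun setT (aff1 l b).
Proof.
by apply: measurable_funD => //; apply: measurable_funM.
Qed.

Lemma scales_measure_aff1 l b : (0 < l)%R -> scales_measure mu l^-1 (aff1 l b).
Proof.
move=> l0 A mA.
have l_ge0 : (0 <= l)%R by exact: ltW.
pose m' := rescaled_pushforward mu l_ge0 (measurable_aff1 l b).
suff E : mu A = m' A.
  rewrite [X in _ = _ * X]E /m'/= /mscale/= /pushforward/=.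
  by rewrite muleA -EFinM mulVf ?mul1e// gt_eqF.
apply: lebesgue_measure_unique mA.
move=> _ [[u v] /= uv <-]; rewrite /m'/= /mscale/= /pushforward/=.
rewrite (_ : _ @^-1` _ = `]((u - b) / l)%R, ((v - b) / l)%R]%classic);
  last first.
  apply/seteqP; split => x; rewrite /= !in_itv/= /aff1;
  by rewrite ltr_pdivrMr// ler_pdivlMr// ltrBlDr lerBrDr mulrC.
rewrite !lebesgue_measure_itv/= !lte_fin ltr_pM2r ?invr_gt0// ltrD2r.
case: ifPn; rewrite ?mule0// => _.
rewrite -EFinB -!EFinM; congr EFin.
by field; rewrite gt_eqF.
Qed.

Definition aff (l : R) (b : R3 R) : R3 R -> R3 R :=
  fun x => (aff1 l b.1.1 x.1.1, aff1 l b.1.2 x.1.2, aff1 l b.2 x.2).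

Lemma measurable_aff l b : measurable_fun setT (aff l b).
Proof.
apply: (@measurable_fun_pair_map _ _ _ _
  (fun x : MR * MR => (aff1 l b.1.1 x.1, aff1 l b.1.2 x.2)) (aff1 l b.2)).
  by apply: measurable_fun_pair_map; exact: measurable_aff1.
exact: measurable_aff1.
Qed.

Lemma scales_measure_aff l b : (0 < l)%R ->
  scales_measure (@leb3 R) (l ^- 3) (aff l b).
Proof.
move=> l0; have li0 : (0 < l^-1)%R by rewrite invr_gt0.
rewrite (_ : (l ^- 3 = l^-1 * l^-1 * l^-1)%R); last first.
  by rewrite -exprVn !exprSr expr0 mul1r.
have m2 : measurable_fun setT
    (fun x : MR * MR => (aff1 l b.1.1 x.1, aff1 l b.1.2 x.2)).
  by apply: measurable_fun_pair_map; exact: measurable_aff1.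
have s2 : scales_measure (mu \x mu) (l^-1 * l^-1)
    (fun x : MR * MR => (aff1 l b.1.1 x.1, aff1 l b.1.2 x.2)).
  apply: scales_measure_prod => //; try exact: measurable_aff1;
  exact: scales_measure_aff1.
pose mm : {sigma_finite_measure set (MR * MR)%type -> \bar R} :=
  sigma_finite_product mu mu.
have := @scales_measure_prod _ _ _ _ _ mm mu _ _ _ _ (mulr_gt0 li0 li0) li0
  m2 (measurable_aff1 l b.2) s2 (scales_measure_aff1 b.2 l0).
exact.
Qed.

Definition aff_inv (l : R) (b : R3 R) : R3 R -> R3 R :=
  aff l^-1 (- (b.1.1 / l), - (b.1.2 / l), - (b.2 / l))%R.

Lemma affK l b : (0 < l)%R -> cancel (aff l b) (aff_inv l b).
Proof.
move=> l0 [[x y] z]; rewrite /aff_inv /aff/= /aff1; congr (_, _, _);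
  by field; rewrite gt_eqF.
Qed.

Lemma aff_invK l b : (0 < l)%R -> cancel (aff_inv l b) (aff l b).
Proof.
move=> l0 [[x y] z]; rewrite /aff_inv /aff/= /aff1; congr (_, _, _);
  by field; rewrite gt_eqF.
Qed.

Lemma integral_aff l b c (f : R3 R -> \bar R) : (0 < l)%R -> (0 < c)%R ->
  \int[leb3 R]_x (c%:E * f (aff l b x)) = (c / l ^+ 3)%:E * \int[leb3 R]_x f x.
Proof.
move=> l0 c0; apply: (@integral_scaled_comp _ _ _ _ _ _ _ (aff_inv l b)) => //.
- by rewrite invr_gt0 exprn_gt0.
- exact: measurable_aff.
- exact: measurable_aff.
- exact: affK.
- exact: aff_invK.
- exact: scales_measure_aff.
Qed.

End AffineR3.

(** * Weak derivatives under affine maps *)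

(** The difference quotient in the direction [l *: v] at the increment [h] is
    [l] times the one in the direction [v] at the increment [l * h]. *)
Lemma is_derive_scaled_dir (R : realType) (V W : normedModType R) (f : V -> W)
    (y v : V) (l : R) (df : W) : l != 0 ->
  is_derive y v f df -> is_derive y (l *: v) f (l *: df).
Proof.
move=> l0 [fd fE].
have H : h^-1 *: (f (h *: v + y) - f y) @[h --> (0:R)^'] --> df.
  by rewrite -fE; exact: fd.
have lim0 : l * h @[h --> (0:R)^'] --> (0:R)^'.
  move=> U /= U0; rewrite !nbhs_simpl/=.
  have cl : l * h @[h --> (0:R)] --> (0:R).
    by rewrite -[X in _ --> X](mulr0 l); exact: mulrl_continuous.
  have := cl _ U0; rewrite /= !nbhs_simpl /=; apply: filterS => h /= Uh h0.
  by apply: Uh; rewrite mulf_neq0.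
have H2 := cvgZ (cvg_cst l) (cvg_comp _ _ lim0 H).
have E : h^-1 *: (f (h *: (l *: v) + y) - f y) @[h --> (0:R)^'] --> l *: df.
  rewrite [X in X @ _ --> _](_ : _ = fun h => l *: ((l * h)^-1 *:
    (f ((l * h) *: v + y) - f y))); first exact: H2.
  apply/funext => h.
  by rewrite !scalerA invfM mulrA mulfV// mul1r (mulrC l).
split; first by apply/cvg_ex; exists (l *: df).
exact: cvg_lim E.
Qed.

Section AffCalculus.
Variable R : realType.
Implicit Types (l : R) (b : R3 R) (f : R3 R -> R).

Lemma continuous_aff l b : continuous (aff l b).
Proof.
have c1 : continuous (fun x : R3 R => x.1.1).
  by move=> u; apply: continuous_comp; exact: cvg_fst.
have c2 : continuous (fun x : R3 R => x.1.2).
  by move=> u; apply: continuous_comp; [exact: cvg_fst|exact: cvg_snd].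
have c3 : continuous (fun x : R3 R => x.2) by move=> u; exact: cvg_snd.
have c (p : R3 R -> R) (d : R) : continuous p ->
    continuous (fun x => l * p x + d).
  move=> cp u; apply: cvgD; last exact: cvg_cst.
  by apply: cvgM; [exact: cvg_cst|exact: cp].
move=> x.
have d1 := c _ b.1.1 c1 x.
have d2 := c _ b.1.2 c2 x.
have d3 := c _ b.2 c3 x.
have := cvg_pair (cvg_pair d1 d2) d3.
exact.
Qed.

Lemma aff_line l b (h : R) (v x : R3 R) :
  aff l b (h *: v + x) = h *: (l *: v) + aff l b x.
Proof.
have E (p q r : R) : l * (h * p + q) + r = h * (l * p) + (l * q + r) by ring.
by congr (_, _, _); exact: E.
Qed.

Lemma is_derive_aff l b f x v df : l != 0 ->
  is_derive (aff l b x) v f df -> is_derive x v (f \o aff l b) (l * df).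
Proof.
move=> l0 /(is_derive_scaled_dir l0) [fd fE].
have E : (fun h : R => h^-1 *: (((f \o aff l b) \o shift x) (h *: v) -
     (f \o aff l b) x)) =
   (fun h : R => h^-1 *: ((f \o shift (aff l b x)) (h *: (l *: v)) -
     f (aff l b x))).
  by apply/funext => h /=; rewrite aff_line.
by split; [rewrite /derivable E|rewrite /derive E].
Qed.

Lemma iter_partial_aff l b f s : l != 0 -> smooth f ->
  iter_partial s (f \o aff l b) =
  (fun x => l ^+ size s * iter_partial s f x) \o aff l b.
Proof.
move=> l0 sf; elim: s => [|i s IH] /=.
  by apply/funext => x /=; rewrite mul1r.
rewrite IH; apply/funext => x /=; rewrite /partial.
have [_ /(_ i (aff l b x)) /derivableP D] := sf s.
have := is_derive_aff l0 (is_deriveZ (l ^+ size s) D).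
by move=> [_ ->]; rewrite exprS -mulrA.
Qed.

Lemma smooth_aff l b f : l != 0 -> smooth f -> smooth (f \o aff l b).
Proof.
move=> l0 sf s; rewrite iter_partial_aff//; have [cf df] := sf s; split.
  move=> x; apply: continuous_comp; first exact: continuous_aff.
  by apply: cvgM; [exact: cvg_cst|exact: cf].
move=> i x; have /derivableP D := df i (aff l b x).
by have [] := is_derive_aff l0 (is_deriveZ (l ^+ size s) D).
Qed.

(** The support of [f \o aff l b] lies in the image of the compact support of
    [f] under the inverse map. *)
Lemma test_function_aff l b f : 0 < l ->
  test_function f -> test_function (f \o aff l b).
Proof.
move=> l0 [sf cf]; split; first by apply: smooth_aff => //; rewrite gt_eqF.
have cinv : continuous (aff_inv l b) by exact: continuous_aff.
have cK := continuous_compact (continuous_subspaceT cinv) cf.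
apply: (subclosed_compact _ cK); first exact: closed_closure.
move=> x; rewrite closureE; apply; split.
  by apply: compact_closed cK; exact: norm_hausdorff.
move=> z /= fz; exists (aff l b z); last exact: affK.
exact: subset_closure.
Qed.

Lemma partial_aff l b f i x : l != 0 -> smooth f ->
  partial i (f \o aff l b) x = l * partial i f (aff l b x).
Proof. by move=> l0 sf; have /= -> := iter_partial_aff b [:: i] l0 sf. Qed.

(** The test function is transported to the other side by the inverse map.  The
    chain rule then yields the factor [l], and the two Jacobians agree. *)
Lemma is_weak_partial_aff l b c i (u g : R3 R -> R) : 0 < l -> 0 < c ->
  is_weak_partial i u g ->
  is_weak_partial i (fun x => c * u (aff l b x))
    (fun x => c * l * g (aff l b x)).
Proof.
move=> l0 c0 ug psi tpsi.
pose eta := psi \o aff_inv l b.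
have teta : test_function eta.
  by apply: test_function_aff => //; rewrite invr_gt0.
have psiE : psi = eta \o aff l b.
  by apply/funext => x; rewrite /eta /= affK.
have cl0 : 0 < c * l by rewrite mulr_gt0.
have uE x : c * u (aff l b x) * partial i psi x =
    c * l * (u (aff l b x) * partial i eta (aff l b x)).
  by rewrite [in LHS]psiE partial_aff ?gt_eqF//; [rewrite mulrACA|case: teta].
under eq_integral do rewrite uE EFinM.
rewrite (integral_aff b (fun x => (u x * partial i eta x)%:E))// ug//.
have gE x : c * l * g (aff l b x) * psi x =
    c * l * (g (aff l b x) * eta (aff l b x)).
  by rewrite [in LHS]psiE mulrA.
under [in RHS]eq_integral do rewrite gE EFinM.
rewrite (integral_aff b (fun x => (g x * eta x)%:E))//.
by rewrite muleN.
Qed.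

End AffCalculus.

(** * The inverse-power potential and Euler's identity *)

Lemma measurable_coords (R : realType) :
  [/\ measurable_fun setT (fun x : R3 R => x.1.1),
      measurable_fun setT (fun x : R3 R => x.1.2) &
      measurable_fun setT (fun x : R3 R => x.2)].
Proof.
split; last exact: measurable_snd.
  by apply: measurableT_comp; [exact: measurable_fst|exact: measurable_fst].
by apply: measurableT_comp; [exact: measurable_snd|exact: measurable_fst].
Qed.

Section Coordinates.
Variable R : realType.
Implicit Types (x z : R3 R).

Lemma sum_ord3 (F : 'I_3 -> R) :
  \sum_(i < 3) F i = F (inord 0) + F (inord 1) + F (inord 2).
Proof.
rewrite !big_ord_recl big_ord0 addr0 addrA.
by congr (F _ + F _ + F _); apply: val_inj; rewrite /= inordK.
Qed.

Lemma enormE x : enorm x = Num.sqrt (x.1.1 ^+ 2 + x.1.2 ^+ 2 + x.2 ^+ 2).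
Proof. by rewrite /enorm sum_ord3 /coord3 !inordK. Qed.

Lemma measurable_enorm : measurable_fun setT (@enorm R).
Proof.
rewrite (_ : @enorm R = fun x =>
    Num.sqrt (x.1.1 ^+ 2 + x.1.2 ^+ 2 + x.2 ^+ 2)); last first.
  by apply/funext => x; exact: enormE.
have ms : measurable_fun setT (@Num.sqrt R).
  by apply: continuous_measurable_fun; exact: sqrt_continuous.
apply: (measurableT_comp ms).
have [m1 m2 m3] := measurable_coords R.
by repeat apply: measurable_funD; apply: measurable_funX.
Qed.

Lemma enorm_ge0 x : 0 <= enorm x. Proof. exact: sqrtr_ge0. Qed.

Lemma enorm_eq0 x : enorm x = 0 -> x = 0.
Proof.
case: x => [[x y] z]; rewrite enormE/= => /eqP; rewrite sqrtr_eq0 => h.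
have h2 : x ^+ 2 + y ^+ 2 + z ^+ 2 == 0.
  by rewrite eq_le h/= !addr_ge0 ?sqr_ge0.
move: h2; rewrite !paddr_eq0 ?addr_ge0 ?sqr_ge0// !sqrf_eq0.
by move=> /andP[/andP[/eqP -> /eqP ->] /eqP ->].
Qed.

Lemma enorm_gt0 x : x != 0 -> 0 < enorm x.
Proof.
move=> x0; rewrite lt_neqAle enorm_ge0 andbT eq_sym.
by apply: contra_neq x0; exact: enorm_eq0.
Qed.

Lemma enormZ (l : R) x : 0 < l -> enorm (l *: x) = l * enorm x.
Proof.
move=> l0; rewrite !enormE; case: x => [[a b] c].
have -> : (l *: (a, b, c) : R3 R) = (l * a, l * b, l * c) by [].
rewrite -[in RHS](@ger0_norm _ l) ?ltW// -(sqrtr_sqr l) -sqrtrM ?sqr_ge0//=.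
by congr Num.sqrt; ring.
Qed.

Lemma derive_line (f : R3 R -> R) x v :
  'D_v f x = 'D_1 (fun h : R => f (h *: v + x)) 0.
Proof.
rewrite /derive; set g1 := fun h => h^-1 *: _; set g2 := fun h => h^-1 *: _.
suff -> : g1 = g2 by [].
by rewrite funeqE /g1 /g2 => h /=; rewrite addr0 scale0r add0r [_%:A]mulr1.
Qed.

Lemma enorm_basis_line (h : R) i x :
  enorm (h *: basis_vec R i + x) ^+ 2 =
  h ^+ 2 + (2 * coord3 i x) * h + enorm x ^+ 2.
Proof.
rewrite !enormE !sqr_sqrtr ?addr_ge0 ?sqr_ge0//.
rewrite /coord3; case: x => [[a b] c].
have -> : h *: basis_vec R i + (a, b, c) = (h * (i == 0%N :> nat)%:R + a,
  h * (i == 1%N :> nat)%:R + b, h * (i == 2%N :> nat)%:R + c) by [].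
by case: i => -[|[|[|//]]] /= _; ring.
Qed.

End Coordinates.

Section InversePower.
Variables (R : realType) (k alpha : R).
Hypotheses (k0 : 0 < k) (alpha0 : alpha != 0).

Lemma measurable_inv_power : measurable_fun setT (inv_power k alpha).
Proof.
apply: measurable_funM => //.
apply: (measurableT_comp (f := (@powR R)^~ (- alpha))).
  exact: measurable_powR.
exact: measurable_enorm.
Qed.

Lemma inv_power_ge0 x : 0 <= inv_power k alpha x.
Proof. by rewrite mulr_ge0 ?powR_ge0// ltW. Qed.

Lemma inv_power_gt0 x : x != 0 -> 0 < inv_power k alpha x.
Proof.
by move=> x0; rewrite mulr_gt0// powR_gt0// enorm_gt0.
Qed.

Lemma inv_power_scale (l : R) x : 0 < l ->
  inv_power k alpha x = l `^ alpha * inv_power k alpha (l *: x).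
Proof.
move=> l0; rewrite /inv_power enormZ// powRM ?enorm_ge0 ?ltW//.
have ll : l `^ alpha * l `^ (- alpha) = 1.
  by rewrite powRN divff// gt_eqF// powR_gt0.
by rewrite mulrCA [l `^ alpha * _]mulrA ll mul1r.
Qed.

Lemma inv_powerE x : inv_power k alpha x = k * (enorm x ^+ 2) `^ (- alpha / 2).
Proof.
rewrite /inv_power -powR_mulrn ?enorm_ge0// -powRrM.
by congr (_ * _ `^ _); field.
Qed.

(** Restricted to a line, [V] is a power of a quadratic polynomial that is
    positive at the point of interest. *)
Lemma partial_inv_power i x : x != 0 -> partial i (inv_power k alpha) x =
  k * (- alpha / 2 * (enorm x ^+ 2) `^ (- alpha / 2 - 1) * (2 * coord3 i x)).
Proof.
move=> x0; rewrite /partial derive_line.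
set s := enorm x ^+ 2; set a := 2 * coord3 i x.
have s0 : 0 < s by rewrite exprn_gt0// enorm_gt0.
have -> : (fun h : R => inv_power k alpha (h *: basis_vec R i + x)) =
    k \*: ((@powR R ^~ (- alpha / 2)) \o (fun h : R => h ^+ 2 + a * h + s)).
  by apply/funext => h; rewrite inv_powerE enorm_basis_line.
pose g h : R := h ^+ 2 + a * h + s.
have g0 : g 0 = s by rewrite /g expr0n/= mulr0 !add0r.
have Dg : is_derive (0 : R) 1 g a.
  apply: is_derive_eq.
  by rewrite !scale0r !add0r addr0 [LHS]mulr1.
have Dp : is_derive (g 0) 1 ((@powR R) ^~ (- alpha / 2))
    (- alpha / 2 * s `^ (- alpha / 2 - 1)).
  by rewrite g0; exact: is_derive1_powR.
have [_ E] := is_deriveZ k (is_derive1_comp Dp Dg).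
exact: E.
Qed.

(** Euler's identity for a function homogeneous of degree [- alpha].  It holds
    at the origin too: there all coordinates vanish, and [V] takes the value
    [0] because a negative power of [0] is [0]. *)
Lemma x_dot_grad_inv_power x :
  x_dot_grad (inv_power k alpha) x = - alpha * inv_power k alpha x.
Proof.
have [->|x0] := eqVneq x 0.
  rewrite /x_dot_grad big1 => [|i _]; last first.
    by rewrite (_ : coord3 i 0 = 0) ?mul0r//; case: i => -[|[|[|//]]].
  rewrite /inv_power enormE/= expr0n/= !addr0 sqrtr0 powR0 ?mulr0//.
  by rewrite oppr_eq0.
rewrite /x_dot_grad sum_ord3 !partial_inv_power// inv_powerE.
have s0 : 0 < enorm x ^+ 2 by rewrite exprn_gt0// enorm_gt0.
have -> : (enorm x ^+ 2) `^ (- alpha / 2) =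
    enorm x ^+ 2 * (enorm x ^+ 2) `^ (- alpha / 2 - 1).
  have /= := @powRD _ (enorm x ^+ 2) 1 (- alpha / 2 - 1).
  rewrite (gt_eqF s0) implybT powRr1 ?ltW// [1 + _]addrC subrK.
  exact.
have sE : enorm x ^+ 2 = coord3 (inord 0) x ^+ 2 + coord3 (inord 1) x ^+ 2 +
    coord3 (inord 2) x ^+ 2.
  by rewrite sqr_sqrtr ?sumr_ge0// => [|i _]; [exact: sum_ord3|exact: sqr_ge0].
set X := _ `^ (- alpha / 2 - 1); rewrite sE {sE}.
by field.
Qed.

End InversePower.

(** * Rescaled and translated elements of H^1 *)

Section H1Affine.
Variable R : realType.
Implicit Types (l c : R) (b : R3 R) (phi : H1 R).
Local Notation leb := (@leb3 R).

Definition scalec c (z : R[i]) : R[i] :=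
  Complex (c * complex.Re z) (c * complex.Im z).

Lemma abs2E (z : R[i]) : abs2 z = complex.Re z ^+ 2 + complex.Im z ^+ 2.
Proof.
by case: z => x y; rewrite /abs2/= sqr_sqrtr// addr_ge0 ?sqr_ge0.
Qed.

Lemma abs2_ge0 (z : R[i]) : 0 <= abs2 z.
Proof. by rewrite /abs2 sqr_ge0. Qed.

Lemma abs2_scalec c z : abs2 (scalec c z) = c ^+ 2 * abs2 z.
Proof. by rewrite !abs2E /=; ring. Qed.

Lemma normc4E (z : R[i]) : Normc.normc z ^+ 4 = abs2 z ^+ 2.
Proof. by rewrite /abs2 -exprM. Qed.

Lemma abs2_eq0 (z : R[i]) : abs2 z = 0 -> z = 0.
Proof.
case: z => x y; rewrite abs2E /= => /eqP.
rewrite paddr_eq0 ?sqr_ge0// !sqrf_eq0 => /andP[/eqP -> /eqP ->].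
by [].
Qed.

Lemma Lfun2_aff l b c (f : R3 R -> R) : 0 < l ->
  f \in Lfun leb 2%:E -> (fun x => c * f (aff l b x)) \in Lfun leb 2%:E.
Proof.
move=> l0 fL.
have fL2 : (f \o aff l b) \in Lfun leb 2%:E.
  move: fL; rewrite !inE => /andP[]; rewrite !inE /= => mf nf.
  apply/andP; rewrite !inE /=; split.
    exact: measurableT_comp mf (measurable_aff l b).
  rewrite /finite_norm unlock /= in nf *.
  rewrite poweR_lty//.
  have := integral_aff b (fun x => (`|f x|%:E `^ 2)%E) l0 (ltr01).
  under eq_integral do rewrite mul1e.
  move=> ->; rewrite lte_mul_pinfty ?lee_fin//.
    by rewrite divr_ge0// exprn_ge0 ?ltW.
  by apply: (@lty_poweRy _ _ 2^-1) nf; rewrite ?invr_eq0 ?pnatr_eq0.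
have := @Lfun_scale _ _ _ leb _ c 2 (ler1n _ 2) fL2.
suff -> : c \o* (f \o aff l b) = (fun x => c * f (aff l b x)) by [].
by apply/funext => x /=; rewrite mulrC.
Qed.

Lemma L2_aff l b c (u : R3 R -> R[i]) : 0 < l ->
  L2 u -> L2 (fun x => scalec c (u (aff l b x))).
Proof.
move=> l0 [ur ui]; split.
  exact: (Lfun2_aff b c l0 ur).
exact: (Lfun2_aff b c l0 ui).
Qed.

Definition H1_rescale phi l b c (l0 : 0 < l) (c0 : 0 < c) : H1 R := MkH1
  (L2_aff b c l0 (H1fun_L2 phi))
  (fun i => L2_aff b (c * l) l0 (H1grad_L2 phi i))
  (fun i => conj (is_weak_partial_aff b l0 c0 (H1grad_weak phi i).1)
                 (is_weak_partial_aff b l0 c0 (H1grad_weak phi i).2)).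

Section Functionals.
Variables (phi : H1 R) (l c : R) (b : R3 R) (l0 : 0 < l) (c0 : 0 < c).
Let psi := H1_rescale phi b l0 c0.
Local Open Scope ereal_scope.

Lemma int_abs2_aff : \int[leb]_x (abs2 (psi x))%:E =
  (c ^+ 2 / l ^+ 3)%:E * \int[leb]_x (abs2 (phi x))%:E.
Proof.
under eq_integral do rewrite /psi /= abs2_scalec EFinM.
by rewrite (integral_aff b (fun x => (abs2 (phi x))%:E))// exprn_gt0.
Qed.

Lemma int_grad_aff : \int[leb]_x (grad_abs2 psi x)%:E =
  ((c * l) ^+ 2 / l ^+ 3)%:E * \int[leb]_x (grad_abs2 phi x)%:E.
Proof.
have E x : grad_abs2 psi x = ((c * l) ^+ 2 * grad_abs2 phi (aff l b x))%R.
  rewrite /grad_abs2 mulr_sumr; apply: eq_bigr => i _.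
  by rewrite /psi /= abs2_scalec.
under eq_integral do rewrite E EFinM.
rewrite (integral_aff b (fun x => (grad_abs2 phi x)%:E))// exprn_gt0//.
by rewrite mulr_gt0.
Qed.

Lemma int_normc4_aff : \int[leb]_x (Normc.normc (psi x) ^+ 4)%:E =
  (c ^+ 4 / l ^+ 3)%:E * \int[leb]_x (Normc.normc (phi x) ^+ 4)%:E.
Proof.
have E x : (Normc.normc (psi x) ^+ 4 =
    c ^+ 4 * Normc.normc (phi (aff l b x)) ^+ 4)%R.
  by rewrite !normc4E /psi/= abs2_scalec exprMn -exprM.
under eq_integral do rewrite E EFinM.
rewrite (integral_aff b (fun x => (Normc.normc (phi x) ^+ 4)%:E))//.
by rewrite exprn_gt0.
Qed.

(** The homogeneity of [V] moves the dilation out of the potential; only the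
    translation by [b] remains. *)
Lemma int_pot_aff (k alpha : R) :
  \int[leb]_x (inv_power k alpha x * abs2 (psi x))%:E =
  (l `^ alpha * c ^+ 2 / l ^+ 3)%:E *
  \int[leb]_x (inv_power k alpha (x - b) * abs2 (phi x))%:E.
Proof.
have E x : (inv_power k alpha x * abs2 (psi x) = l `^ alpha * c ^+ 2 *
    (inv_power k alpha (aff l b x - b) * abs2 (phi (aff l b x))))%R.
  rewrite /psi/= abs2_scalec (@inv_power_scale _ _ _ l)//.
  have -> : (l *: x = aff l b x - b)%R.
    by case: x b => [[x1 x2] x3] [[b1 b2] b3]; congr (_, _, _);
      rewrite /= addrK.
  by rewrite mulrACA.
under eq_integral do rewrite E EFinM.
rewrite (integral_aff b (fun x =>
  (inv_power k alpha (x - b) * abs2 (phi x))%:E))//.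
by rewrite mulr_gt0 ?powR_gt0 ?exprn_gt0.
Qed.

End Functionals.

End H1Affine.

(** * Cubes, finiteness and vanishing of integrals *)

Section Box.
Local Open Scope ereal_scope.
Variable R : realType.
Local Notation MR := (measurableTypeR R).
Local Notation mu := (@lebesgue_measure R).

Definition leb3_sigma_finite : {sigma_finite_measure set (R3 R) -> \bar R} :=
  sigma_finite_product (sigma_finite_product mu mu) mu.

Definition cube (a : R3 R) (s : R) : set (R3 R) :=
  `[a.1.1, (a.1.1 + s)%R]%classic `*` `[a.1.2, (a.1.2 + s)%R]%classic
  `*` `[a.2, (a.2 + s)%R]%classic.

Lemma measurable_cube a s : measurable (cube a s).
Proof. by apply: measurableX => //; exact: measurableX. Qed.

Lemma leb3_cube a (s : R) : (0 <= s)%R -> leb3 R (cube a s) = (s ^+ 3)%:E.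
Proof.
move=> s0.
have I (u : R) : mu `[u, (u + s)%R]%classic = s%:E.
  rewrite lebesgue_measure_itv/= lte_fin ltrDl.
  case: ltgtP s0 => // [s0 _|<- _//].
  by rewrite -EFinB addrAC subrr add0r.
rewrite (_ : leb3 R (cube a s) = (mu `[a.1.1, (a.1.1 + s)%R]%classic *
  mu `[a.1.2, (a.1.2 + s)%R]%classic) * mu `[a.2, (a.2 + s)%R]%classic).
  by rewrite !I -!EFinM !exprS expr0 mulr1 mulrA.
rewrite /leb3 /cube /= product_measure1E//=; last exact: measurableX.
by congr (_ * _); rewrite product_measure1E.
Qed.

Lemma point_cube (a : R3 R) : [set a] = cube a 0.
Proof.
case: a => [[a1 a2] a3]; apply/seteqP; split => [_ ->|[[x y] z]]/=.
  by rewrite /cube/= !in_itv/= !addr0 !lexx.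
rewrite /cube/= !in_itv/= !addr0 => -[[h1 h2] h3].
by congr (_, _, _); apply/eqP; rewrite eq_le andbC.
Qed.

Lemma leb3_point (a : R3 R) : leb3 R [set a] = 0.
Proof. by rewrite point_cube leb3_cube// expr0n. Qed.

End Box.

Section Measurability.
Variable R : realType.
Local Notation leb := (@leb3 R).

Lemma measurable_abs2 (u : R3 R -> R[i]) : L2 u ->
  measurable_fun setT (fun x => abs2 (u x)).
Proof.
move=> [/sub_Lfun_mfun/set_mem mr /sub_Lfun_mfun/set_mem mi].
rewrite (_ : (fun x => _) =
    fun x => complex.Re (u x) ^+ 2 + complex.Im (u x) ^+ 2).
  by apply: measurable_funD; apply: measurable_funX.
by apply/funext => x; rewrite abs2E.
Qed.

Lemma integral_abs2_lty (u : R3 R -> R[i]) : L2 u ->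
  (\int[leb]_x (abs2 (u x))%:E < +oo)%E.
Proof.
move=> [/Lfun2_integrable_sqr mr /Lfun2_integrable_sqr mi].
have /integrableP[_] := integrableD measurableT mr mi.
apply: le_lt_trans; rewrite le_eqVlt; apply/orP; left; apply/eqP.
apply: eq_integral => x _; rewrite abs2E /= ger0_norm//.
by rewrite addr_ge0 ?sqr_ge0.
Qed.

Lemma integral_grad_abs2_lty (phi : H1 R) :
  (\int[leb]_x (grad_abs2 phi x)%:E < +oo)%E.
Proof.
rewrite /grad_abs2.
under eq_integral do rewrite -sumEFin.
rewrite ge0_integral_sum//; last 2 first.
- move=> i; apply/measurable_EFinP; exact: measurable_abs2 (H1grad_L2 phi i).
- by move=> i x _; rewrite lee_fin abs2_ge0.
by apply: lte_sum_pinfty => i _; exact: integral_abs2_lty (H1grad_L2 phi i).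
Qed.

Lemma ge0_integral_ae_eq0 (f : R3 R -> R) : measurable_fun setT f ->
  (forall x, 0 <= f x) -> (\int[leb]_x (f x)%:E = 0)%E <->
  {ae leb, forall x, f x = 0}.
Proof.
move=> mf f0.
have := ae_eq_integral_abs leb measurableT (f := EFin \o f).
have -> : (\int[leb]_x `|(EFin \o f) x| = \int[leb]_x (f x)%:E)%E.
  by apply: eq_integral => x _; rewrite gee0_abs// lee_fin.
move=> -> //; last exact/measurable_EFinP.
by split; apply: filterS => x /=; [move=> /(_ I) [->]|move=> -> _].
Qed.

Lemma H1_neq0P (phi : H1 R) :
  H1_neq0 phi <-> (\int[leb]_x (abs2 (phi x))%:E != 0)%E.
Proof.
have H := ge0_integral_ae_eq0 (measurable_abs2 (H1fun_L2 phi))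
  (fun x => abs2_ge0 _).
split.
  move=> phi0; apply/eqP => /H phi1; apply: phi0.
  by apply: filterS phi1 => x; exact: abs2_eq0.
move=> /eqP phi0 phi1; apply: phi0; apply/H.
by apply: filterS phi1 => x ->; rewrite abs2E /= expr0n addr0.
Qed.

End Measurability.

(** * Averaging the potential energy over translations *)

Lemma measurable_sub3 (R : realType) d (T : measurableType d)
    (f g : T -> R3 R) : measurable_fun setT f -> measurable_fun setT g ->
  measurable_fun setT (fun t => f t - g t).
Proof.
move=> mf mg.
have [m1 m2 m3] := measurable_coords R.
have mB (p : R3 R -> R) : measurable_fun setT p ->
    measurable_fun setT (fun t => p (f t) - p (g t)).
  move=> mp; apply: measurable_funB.
    exact: measurableT_comp mp mf.
  exact: measurableT_comp mp mg.
exact: measurable_fun_pair (measurable_fun_pair (mB _ m1) (mB _ m2)) (mB _ m3).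
Qed.

Lemma measurable_subr (R : realType) (x : R3 R) :
  measurable_fun setT (fun b : R3 R => x - b).
Proof. exact: measurable_sub3. Qed.

Section Kernel.
Variables (R : realType) (k alpha : R).
Hypotheses (k0 : 0 < k) (alpha0 : 0 < alpha) (alpha2 : alpha <= 2).
Local Notation leb := (@leb3 R).
Local Notation V := (inv_power k alpha).

Definition dyadic_ball (rho : R) (n : nat) : set (R3 R) :=
  [set y | enorm y <= rho / 2 ^+ n].

Lemma dyadic_shell (r : R) : 0 < r -> r <= 1 ->
  exists n, (2 ^+ n.+1)^-1 < r <= (2 ^+ n)^-1.
Proof.
move=> r0 r1.
have ex : exists n, (2 ^+ n.+1)^-1 < r.
  exists (Num.bound r^-1).
  rewrite invf_plt ?posrE ?exprn_gt0//.
  have /archi_boundP : 0 <= r^-1 by rewrite invr_ge0 ltW.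
  move/lt_trans; apply; rewrite -natrX ltr_nat.
  by rewrite (ltn_trans _ (ltn_expl _ _))//.
case: (ex_minnP ex) => n nr nmin; exists n; rewrite nr/=.
case: n nr nmin => [|n] nr nmin; first by rewrite expr0 invr1.
by rewrite leNgt; apply/negP => /nmin; rewrite ltnn.
Qed.

Lemma inv_power_decr (s : R) (y : R3 R) : 0 < s -> s <= enorm y ->
  V y <= k * s `^ (- alpha).
Proof.
move=> s0 sy; rewrite ler_pM2l// !powRN lef_pV2 ?posrE ?powR_gt0//; last first.
  exact: lt_le_trans sy.
apply: ge0_ler_powR => //;
  by rewrite ?nnegrE ?enorm_ge0 ?(ltW s0) ?(ltW alpha0).
Qed.

Lemma powR_dyadic n : (2 ^+ n)^-1 `^ (- alpha) <= 4 ^+ n.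
Proof.
have p0 : 0 < (2 ^+ n : R)^-1 by rewrite invr_gt0 exprn_gt0.
rewrite powRN -[leRHS]invrK lef_pV2 ?posrE ?powR_gt0 ?invr_gt0 ?exprn_gt0//.
have -> : (4 ^+ n)^-1 = (2 ^+ n : R)^-1 `^ 2.
  rewrite powR_mulrn ?ltW// exprVn -exprM mulnC exprM.
  by have -> : 2 ^+ 2 = 4 :> R by ring.
by apply: ger_powR => //; rewrite p0/= invf_le1 ?exprn_gt0// exprn_ege1// ler1n.
Qed.

(** A layered bound on the singularity.  Outside the ball of radius [rho] the
    constant term dominates [V].  A point [y] of the ball lies in the shell
    [rho / 2 ^ n.+1 < |y| <= rho / 2 ^ n] for some [n], and there
    [V y <= k rho^(-alpha) 2^(alpha (n + 1))], which the [n]-th term of the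
    series dominates since [alpha <= 2]. *)
Lemma inv_power_dyadic_bound (rho : R) (y : R3 R) : 0 < rho ->
  ((V y)%:E <= (k * rho `^ (- alpha))%:E *
    (1 + \sum_(n <oo) (4 ^+ n.+1 * \1_(dyadic_ball rho n) y)%:E))%E.
Proof.
move=> rho0.
have k1 : (0 <= (k * rho `^ (- alpha))%:E)%E.
  by rewrite lee_fin mulr_ge0 ?powR_ge0 ?ltW.
have t0 n : (0 <= (4 ^+ n.+1 * \1_(dyadic_ball rho n) y : R)%:E)%E.
  by rewrite lee_fin mulr_ge0 ?exprn_ge0.
have s0 : (0 <= \sum_(n <oo) (4 ^+ n.+1 * \1_(dyadic_ball rho n) y : R)%:E)%E.
  by apply: nneseries_ge0.
have [y0|y0] := eqVneq y 0.
  have -> : V y = 0.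
    rewrite y0 /inv_power enormE/= expr0n/= !addr0 sqrtr0 powR0 ?mulr0//.
    by rewrite oppr_eq0 gt_eqF.
  by apply: mule_ge0 => //; exact: adde_ge0.
have e0 := enorm_gt0 y0.
have [yrho|rhoy] := leP (enorm y) rho; last first.
  apply: (@le_trans _ _ (k * rho `^ (- alpha))%:E).
    by rewrite lee_fin; apply: inv_power_decr => //; exact: ltW.
  by rewrite -[leLHS]mule1 lee_wpmul2l// leeDl.
have [n /andP[n1 n2]] := @dyadic_shell (enorm y / rho) (divr_gt0 e0 rho0)
  ltac:(by rewrite ler_pdivrMr ?mul1r).
have yn : dyadic_ball rho n y.
  by rewrite /dyadic_ball/=; move: n2; rewrite ler_pdivrMr// mulrC.
apply: (@le_trans _ _ ((k * rho `^ (- alpha))%:E * (4 ^+ n.+1)%:E)%E).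
  rewrite -EFinM lee_fin.
  have p0 : 0 < rho / 2 ^+ n.+1 by rewrite divr_gt0// exprn_gt0.
  apply: le_trans (inv_power_decr p0 _) _.
    by move: n1; rewrite ltr_pdivlMr// mulrC => /ltW.
  have u0 : 0 <= (2 ^+ n.+1 : R)^-1 by rewrite invr_ge0 exprn_ge0.
  rewrite (powRM _ (ltW rho0) u0) -!mulrA ler_pM2l//.
  by rewrite ler_pM2l ?powR_gt0// powR_dyadic.
apply: lee_wpmul2l => //.
apply: (@le_trans _ _
  (\sum_(n <oo) (4 ^+ n.+1 * \1_(dyadic_ball rho n) y : R)%:E)%E).
  apply: le_trans (nneseries_lim_ge n.+1 (fun i _ _ => t0 i)).
  rewrite big_nat_recr//= indicE mem_set// mulr1 leeDr//.
  by apply: sume_ge0 => i _; exact: t0.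
by rewrite leeDr.
Qed.

Lemma measurable_dyadic_ball rho n : measurable (dyadic_ball rho n).
Proof.
rewrite (_ : dyadic_ball rho n = @enorm R @^-1` `]-oo, (rho / 2 ^+ n)]).
  by rewrite -[X in measurable X]setTI; exact: measurable_enorm.
by apply/seteqP; split => y; rewrite /dyadic_ball /= in_itv/=.
Qed.

Lemma enorm_coord (y : R3 R) :
  [/\ `|y.1.1| <= enorm y, `|y.1.2| <= enorm y & `|y.2| <= enorm y].
Proof.
have H (s t : R) : 0 <= s -> `|t| <= Num.sqrt (t ^+ 2 + s).
  by move=> s0; rewrite -sqrtr_sqr ler_wsqrtr// lerDl.
rewrite enormE; split.
- by rewrite -addrA; apply: H; rewrite addr_ge0 ?sqr_ge0.
- by rewrite -addrA addrCA; apply: H; rewrite addr_ge0 ?sqr_ge0.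
- by rewrite addrC; apply: H; rewrite addr_ge0 ?sqr_ge0.
Qed.

(** A cube around the ball gives an upper bound on its volume that is computed
    by products only. *)
Lemma dyadic_ball_sub_cube rho n (x : R3 R) :
  [set b | dyadic_ball rho n (x - b)%R] `<=`
  cube (x.1.1 - rho / 2 ^+ n, x.1.2 - rho / 2 ^+ n, x.2 - rho / 2 ^+ n)
    (2 * (rho / 2 ^+ n)).
Proof.
case: x => [[x1 x2] x3] [[b1 b2] b3]; rewrite /dyadic_ball /= => h.
have H (t b : R) : `|t - b| <= rho / 2 ^+ n ->
    b \in `[t - rho / 2 ^+ n, t - rho / 2 ^+ n + 2 * (rho / 2 ^+ n)].
  by rewrite in_itv/= ler_norml => /andP[? ?]; apply/andP; split; lra.
have [h1 h2 h3] := enorm_coord ((x1, x2, x3) - (b1, b2, b3) : R3 R).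
by split; [split|]; apply: H; [apply: le_trans h1 h|apply: le_trans h2 h|
  apply: le_trans h3 h].
Qed.

Lemma leb3_dyadic_ball rho n (x : R3 R) : 0 < rho ->
  (leb [set b | dyadic_ball rho n (x - b)%R] <=
   ((2 * (rho / 2 ^+ n)) ^+ 3)%:E)%E.
Proof.
move=> rho0.
set s := rho / 2 ^+ n.
rewrite -(leb3_cube (x.1.1 - s, x.1.2 - s, x.2 - s)).
  rewrite le_measure ?inE//; last 2 first.
  - exact: measurable_cube.
  - exact: dyadic_ball_sub_cube.
  rewrite -[X in measurable X]setTI.
  by apply: measurable_subr => //; exact: measurable_dyadic_ball.
by rewrite mulr_ge0// divr_ge0 ?exprn_ge0 ?ltW.
Qed.

(** The [n]-th layer has weight [4 ^ n.+1] and volume at most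
    [8 rho^3 / 8 ^ n], so that it contributes at most
    [32 rho^3 / 2 ^ n]; the sum over [n] is [64 rho^3], to which the cube
    itself adds [rho^3].  The series converges because the exponent of the
    singularity is smaller than the dimension. *)
Lemma cube_average_bound rho (x : R3 R) : 0 < rho ->
  (\int[leb]_b ((\1_(cube 0%R rho) b * V (x - b)%R)%:E) <=
   (65 * k * rho `^ (- alpha) * rho ^+ 3)%:E)%E.
Proof.
move=> rho0.
have mD n : measurable_fun setT
    (fun b : R3 R => (4 ^+ n.+1 * \1_(dyadic_ball rho n) (x - b) : R)%:E).
  apply/measurable_EFinP; apply: measurable_funM => //.
  apply: measurableT_comp (measurable_subr x).
  by apply: measurable_indic; exact: measurable_dyadic_ball.
have D0 n (b : R3 R) :
    (0 <= (4 ^+ n.+1 * \1_(dyadic_ball rho n) (x - b) : R)%:E)%E.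
  by rewrite lee_fin mulr_ge0 ?exprn_ge0.
have mC : measurable_fun setT (fun b : R3 R => (\1_(cube 0%R rho) b : R)%:E).
  by apply/measurable_EFinP; apply: measurable_indic; exact: measurable_cube.
have k1 : 0 <= k * rho `^ (- alpha) by rewrite mulr_ge0 ?powR_ge0 ?ltW.
apply: (@le_trans _ _ (\int[leb]_b ((k * rho `^ (- alpha))%:E *
  ((\1_(cube 0%R rho) b)%:E +
   \sum_(n <oo) (4 ^+ n.+1 * \1_(dyadic_ball rho n) (x - b)%R)%:E)))%E).
  apply: ge0_le_integral => //.
  - by move=> b _; rewrite lee_fin mulr_ge0 ?inv_power_ge0.
  - apply/measurable_EFinP; apply: measurable_funM.
      by apply: measurable_indic; exact: measurable_cube.
    exact: measurableT_comp (measurable_inv_power k alpha) (measurable_subr x).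
  - apply: measurable_funeM; apply: emeasurable_funD => //.
    by apply: ge0_emeasurable_sum.
  - move=> b _; rewrite indicE; case: (b \in _) => /=.
      by rewrite mul1r; exact: inv_power_dyadic_bound.
    rewrite mul0r mule_ge0// add0e; exact: nneseries_ge0.
rewrite ge0_integralZl//; last 2 first.
- apply: emeasurable_funD => //; by apply: ge0_emeasurable_sum.
- by move=> b _; rewrite adde_ge0// ?lee_fin//; exact: nneseries_ge0.
rewrite ge0_integralD//; last 2 first.
- by move=> b _; exact: nneseries_ge0.
- by apply: ge0_emeasurable_sum.
rewrite integral_nneseries// integral_indic ?setIT//; last first.
  exact: measurable_cube.
rewrite leb3_cube ?(ltW rho0)//.
have S : (\sum_(n <oo)
    \int[leb]_b ((4 ^+ n.+1 * \1_(dyadic_ball rho n) (x - b)%R)%:E)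
   <= (64 * rho ^+ 3)%:E)%E.
  have e0 : 0 <= 64 * rho ^+ 3 by rewrite mulr_ge0// exprn_ge0// ltW.
  (* The geometric series: [64 rho^3 / 2 ^ n.+1] sums to at most [64 rho^3]. *)
  have := @epsilon_trick R (fun=> 0%E) _ xpredT (fun=> lexx _) e0.
  rewrite [X in (_ <= X + _)%E]eseries0// add0e; apply: le_trans.
  apply: lee_nneseries => [n _ _|n _].
    by apply: integral_ge0 => b _; exact: D0.
  under eq_integral do rewrite EFinM.
  rewrite ge0_integralZl//; last first.
  - apply/measurable_EFinP; apply: measurableT_comp (measurable_subr x).
    by apply: measurable_indic; exact: measurable_dyadic_ball.
  rewrite add0e.
  have -> : (\int[leb]_b (\1_(dyadic_ball rho n) (x - b)%R)%:E =
     leb [set b | dyadic_ball rho n (x - b)%R])%E.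
    rewrite -(setIT [set b | _]) -integral_indic//.
    rewrite -[X in measurable X]setTI.
    by apply: measurable_subr => //; exact: measurable_dyadic_ball.
  apply: le_trans (lee_wpmul2l _ (leb3_dyadic_ball n x rho0)) _ => //.
  rewrite -EFinM lee_fin le_eqVlt; apply/orP; left; apply/eqP.
  rewrite natrX (_ : 4 = 2 * 2 :> R); last by ring.
  rewrite exprMn !exprS.
  by field; rewrite expf_neq0.
apply: (@le_trans _ _ ((k * rho `^ (- alpha))%:E *
    ((rho ^+ 3)%:E + (64 * rho ^+ 3)%:E))%E).
  by apply: lee_wpmul2l; [rewrite lee_fin|exact: leeD2l].
by rewrite -EFinD -EFinM lee_fin le_eqVlt; apply/orP; left; apply/eqP; ring.
Qed.

End Kernel.

Section Averaging.
Variables (R : realType) (k alpha : R).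
Hypotheses (k0 : 0 < k) (alpha0 : 0 < alpha) (alpha2 : alpha <= 2).
Local Notation leb := (@leb3 R).
Local Notation V := (inv_power k alpha).
Variable w : R3 R -> R.
Hypotheses (mw : measurable_fun setT w) (w0 : forall x, 0 <= w x).
Hypothesis wfin : (\int[leb]_x (w x)%:E < +oo)%E.

Let F rho (z : R3 R * R3 R) : \bar R :=
  (\1_(cube 0 rho) z.1 * (V (z.2 - z.1) * w z.2))%:E.

Let F0 rho z : (0 <= F rho z)%E.
Proof. by rewrite lee_fin mulr_ge0// mulr_ge0// inv_power_ge0. Qed.

Let mF rho : measurable_fun setT (F rho).
Proof.
apply/measurable_EFinP; apply: measurable_funM.
  apply: measurableT_comp measurable_fst.
  by apply: measurable_indic; exact: measurable_cube.
apply: measurable_funM; last exact: measurableT_comp mw measurable_snd.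
have ms : measurable_fun setT (fun z : R3 R * R3 R => z.2 - z.1).
  by apply: measurable_sub3; [exact: measurable_snd|exact: measurable_fst].
exact: (measurableT_comp (measurable_inv_power k alpha) ms).
Qed.

(** Tonelli: the average over [b] of the potential energies is at least [eps],
    and exchanging the integrals bounds it by the kernel estimate. *)
Lemma cube_average_potential rho (eps : R) : 0 < rho -> 0 < eps ->
  (forall b, (eps%:E <= \int[leb]_x (V (x - b)%R * w x)%:E)%E) ->
  (eps%:E <= (65 * k * rho `^ (- alpha))%:E * \int[leb]_x (w x)%:E)%E.
Proof.
move=> rho0 eps0 H.
have r30 : 0 < rho ^+ 3 by rewrite exprn_gt0.
rewrite -(@lee_pmul2l _ (rho ^+ 3)%:E)//.
have -> : ((rho ^+ 3)%:E * eps%:E =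
    \int[leb]_b (eps%:E * (\1_(cube 0 rho) b)%:E))%E.
  rewrite ge0_integralZl ?lee_fin ?(ltW eps0)//; last first.
    apply/measurable_EFinP; apply: measurable_indic; exact: measurable_cube.
  rewrite integral_indic ?setIT//; last exact: measurable_cube.
  by rewrite leb3_cube ?(ltW rho0)// muleC.
apply: (@le_trans _ _ (\int[leb3_sigma_finite R]_b
    \int[leb3_sigma_finite R]_x F rho (b, x))%E).
  apply: ge0_le_integral => //.
  - by move=> b _; rewrite mule_ge0 ?lee_fin// ltW.
  - apply: measurable_funeM; apply/measurable_EFinP; apply: measurable_indic.
    exact: measurable_cube.
  - exact: measurable_fun_fubini_tonelli_F.
  - move=> b _; rewrite indicE; have [bC|bC] := boolP (b \in cube 0 rho).
      rewrite mule1; apply: le_trans (H b) _.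
      by under [leRHS]eq_integral do rewrite /F/= indicE bC mul1r.
    by rewrite mule0; apply: integral_ge0.
rewrite fubini_tonelli//.
apply: (@le_trans _ _ (\int[leb]_x
    ((65 * k * rho `^ (- alpha) * rho ^+ 3)%:E * (w x)%:E))%E).
  apply: ge0_le_integral => //.
  - by move=> x _; apply: integral_ge0.
  - exact: measurable_fun_fubini_tonelli_G.
  - by apply: measurable_funeM; exact/measurable_EFinP.
  - move=> x _.
    have E b : F rho (b, x) =
        ((w x)%:E * (\1_(cube 0 rho) b * V (x - b)%R)%:E)%E.
      by rewrite /F /= -EFinM mulrA mulrC.
    under eq_integral do rewrite E.
    rewrite ge0_integralZl//; last 3 first.
    + apply/measurable_EFinP; apply: measurable_funM.
        by apply: measurable_indic; exact: measurable_cube.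
      exact: measurableT_comp (measurable_inv_power k alpha)
        (measurable_subr x).
    + by move=> b _; rewrite lee_fin mulr_ge0 ?inv_power_ge0.
    + by rewrite lee_fin.
    + rewrite muleC lee_wpmul2r ?lee_fin//.
      exact: cube_average_bound.
rewrite ge0_integralZl//; last 3 first.
- exact/measurable_EFinP.
- by move=> x _; rewrite lee_fin.
- rewrite lee_fin mulr_ge0 ?(ltW r30)// mulr_ge0 ?powR_ge0// mulr_ge0//.
  exact: ltW.
by rewrite muleA -EFinM (mulrC (rho ^+ 3)).
Qed.

(** If all translates had potential energy at least [eps], then so would all
    averages, but these tend to [0] as the side of the cube grows. *)
Lemma exists_small_translate (eps : R) : 0 < eps ->
  exists b, (\int[leb]_x (V (x - b)%R * w x)%:E < eps%:E)%E.
Proof.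
move=> eps0; apply: contrapT => /forallNP nH.
have H b : (eps%:E <= \int[leb]_x (V (x - b)%R * w x)%:E)%E.
  by rewrite leNgt; apply/negP; exact: nH.
have W0 : (0 <= \int[leb]_x (w x)%:E)%E.
  by apply: integral_ge0 => x _; rewrite lee_fin.
move: wfin W0; case WE : (\int[leb]_x (w x)%:E)%E => [W||]// _.
rewrite lee_fin => W0.
pose c := 65 * k * W + 1.
have c0 : 0 < c by rewrite ltr_wpDl// mulr_ge0// mulr_ge0// ltW.
pose d := eps / c.
have d0 : 0 < d by rewrite divr_gt0.
(* This side of the cube makes [rho^(-alpha)] equal to [d]. *)
have := @cube_average_potential (d `^ (- alpha^-1)) eps.
rewrite powR_gt0// WE -powRrM => /(_ isT eps0 H).
rewrite mulrNN mulVf ?gt_eqF// powRr1 ?(ltW d0)// -EFinM lee_fin.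
rewrite leNgt => /negP; apply.
rewrite [ltLHS](_ : _ = eps * ((65 * k * W) / c)); last by rewrite /d; ring.
rewrite -[ltRHS]mulr1 ltr_pM2l// ltr_pdivrMr// mul1r /c ltrDl//.
Qed.

End Averaging.

(** * The functionals for the inverse-power potential *)

Section Functionals.
Variables (R : realType) (k alpha : R).
Hypotheses (k0 : 0 < k) (alpha0 : 0 < alpha).
Local Notation leb := (@leb3 R).
Local Notation V := (inv_power k alpha).

Lemma P_functional_inv_power (phi : H1 R) :
  P_functional V phi = (2%:E * \int[leb]_x (grad_abs2 phi x)%:E
   + alpha%:E * \int[leb]_x (V x * abs2 (phi x))%:E
   - (3 / 2)%:E * \int[leb]_x (Normc.normc (phi x) ^+ 4)%:E)%E.
Proof.
rewrite /P_functional.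
have E x : (x_dot_grad V x * abs2 (phi x))%:E =
    (- (alpha%:E * (V x * abs2 (phi x))%:E))%E.
  rewrite x_dot_grad_inv_power ?gt_eqF//.
  by rewrite !mulNr -mulrA EFinN EFinM.
under [in X in (_ - X - _)%E]eq_integral do rewrite E.
have m : measurable_fun setT (fun x => V x * abs2 (phi x)).
  apply: measurable_funM; first exact: measurable_inv_power.
  exact: measurable_abs2 (H1fun_L2 phi).
have p x : (0 <= (V x * abs2 (phi x))%:E)%E.
  by rewrite lee_fin mulr_ge0 ?inv_power_ge0 ?abs2_ge0.
rewrite integral_ge0N//; last first.
  by move=> x _; rewrite mule_ge0// lee_fin ltW.
rewrite ge0_integralZl ?oppeK//; first exact/measurable_EFinP.
by rewrite lee_fin ltW.
Qed.

(** The translated potential is positive except at the point [b], which is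
    negligible. *)
Lemma int_pot_gt0 (phi : H1 R) (b : R3 R) : H1_neq0 phi ->
  (0 < \int[leb]_x (V (x - b)%R * abs2 (phi x))%:E)%E.
Proof.
move=> phi0.
have p x : 0 <= V (x - b)%R * abs2 (phi x).
  by rewrite mulr_ge0 ?inv_power_ge0 ?abs2_ge0.
rewrite lt_neqAle integral_ge0 ?andbT; last by move=> x _; rewrite lee_fin.
rewrite eq_sym; apply/eqP => /ge0_integral_ae_eq0 H; apply: phi0.
have {}H : {ae leb, forall x, V (x - b)%R * abs2 (phi x) = 0}.
  apply: H => //; apply: measurable_funM; last first.
    exact: measurable_abs2 (H1fun_L2 phi).
  have ms : measurable_fun setT (fun x : R3 R => x - b).
    exact: measurable_sub3.
  exact: (measurableT_comp (measurable_inv_power k alpha) ms).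
have nb : {ae leb, forall x, x != b}.
  exists [set b]; split => //.
  - by rewrite point_cube; exact: measurable_cube.
  - exact: leb3_point.
  - by move=> x /= /negP; rewrite negbK => /eqP.
apply: (@filterS2 _ _ (ae_filter_ringOfSetsType leb) _ _ _ _ H nb).
move=> x /eqP + xb; rewrite mulf_eq0 => /orP[|/eqP].
  by rewrite gt_eqF// inv_power_gt0// subr_eq0.
exact: abs2_eq0.
Qed.

End Functionals.

(** * Restoring the constraint lowers the energy *)

Section RealArithmetic.
Variable R : realType.
Implicit Types A B M Q alpha beta l : R.

(** Intermediate values.  The constraint function is negative at [1].  For small
    [l] it is positive, because [l^alpha >= l^2] makes the term in [beta]
    dominate the cubic one. *)
Lemma scaling_root A beta Q alpha : 0 <= A -> 0 < beta -> 0 < Q ->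
  0 < alpha -> alpha <= 2 -> 2 * A + alpha * beta < 3 / 2 * Q ->
  exists l, [/\ 0 < l, l < 1 &
    2 * (l ^+ 2 * A) + alpha * (l `^ alpha * beta) = 3 / 2 * (l ^+ 3 * Q)].
Proof.
move=> A0 b0 Q0 a0 a2 neg.
pose g l :=
  2 * (l ^+ 2 * A) + alpha * (l `^ alpha * beta) - 3 / 2 * (l ^+ 3 * Q).
have ab0 : 0 < alpha * beta by exact: mulr_gt0.
(* Half of the value at which [alpha * beta * l ^ 2] and [3 / 2 * Q * l ^ 3]
   balance. *)
pose d := alpha * beta / (3 * Q).
have d0 : 0 < d by rewrite divr_gt0// mulr_gt0.
have dQ : d * (3 * Q) = alpha * beta by rewrite mulfVK// gt_eqF// mulr_gt0.
have d1 : d < 1.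
  by rewrite ltr_pdivrMr ?mulr_gt0// mul1r; lra.
have gd : 0 < g d.
  have da : d ^+ 2 <= d `^ alpha.
    rewrite -powR_mulrn ?(ltW d0)//; apply: ger_powR => //.
    by rewrite d0 ltW.
  have h1 : d ^+ 2 * (alpha * beta) <= d `^ alpha * (alpha * beta).
    by rewrite ler_pM2r.
  have h2 : 0 < d ^+ 2 * (alpha * beta) by rewrite mulr_gt0// exprn_gt0.
  have h3 : d ^+ 3 * Q * 3 = d ^+ 2 * (alpha * beta) by rewrite -dQ; ring.
  have h4 : 0 <= d ^+ 2 * A by rewrite mulr_ge0// sqr_ge0.
  rewrite /g (mulrCA alpha); lra.
have g1 : g 1 < 0.
  by rewrite /g !expr1n powR1 !mul1r; lra.
have gc : {within `[d, 1], continuous g}.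
  apply: derivable_within_continuous => x; rewrite in_itv/= => /andP[dx _].
  have x0 : 0 < x by exact: lt_le_trans dx.
  apply: derivableB; [apply: derivableD|].
  - by apply: derivableM => //; apply: derivableM => //; exact: exprn_derivable.
  - apply: derivableM => //; apply: derivableM => //.
    by apply: derivable_powR; rewrite in_itv/= x0.
  - by apply: derivableM => //; apply: derivableM => //; exact: exprn_derivable.
have [|l] := IVT (ltW d1) gc (v := 0).
  by rewrite ge_min le_max (ltW g1) (ltW gd) orbT.
rewrite in_itv/= => /andP[dl l1] gl; exists l; split.
- exact: lt_le_trans dl.
- by rewrite lt_neqAle l1 andbT; apply: contraTneq g1 => <-; rewrite gl ltxx.
- by apply/eqP; rewrite -subr_eq0; apply/eqP.
Qed.

(** By the two constraints, the energies are
    [Q / 8 + (2 - alpha) / 4 * B + M / 2] and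
    [l^3 Q / 8 + (2 - alpha) / 4 * (l^alpha beta) + M / 2]. *)
Lemma energy_decrease A B M Q alpha beta l : 0 < Q -> 0 < alpha -> alpha <= 2 ->
  0 < beta -> beta < B -> 0 < l -> l < 1 ->
  2 * A + alpha * B = 3 / 2 * Q ->
  2 * (l ^+ 2 * A) + alpha * (l `^ alpha * beta) = 3 / 2 * (l ^+ 3 * Q) ->
  1 / 2 * (l ^+ 2 * A) + 1 / 2 * (l `^ alpha * beta) + 1 / 2 * M
    - 1 / 4 * (l ^+ 3 * Q) <
  1 / 2 * A + 1 / 2 * B + 1 / 2 * M - 1 / 4 * Q.
Proof.
move=> Q0 a0 a2 b0 bB l0 l1 P1 Pl.
have lQ : l ^+ 3 * Q < Q by rewrite gtr_pMl// exprn_ilt1// ltW.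
have lb : l `^ alpha * beta <= beta.
  rewrite ger_pMl// -(powRr0 l); apply: ger_powR; last exact: ltW.
  by rewrite l0 ltW.
have h : 0 <= (2 - alpha) * (B - l `^ alpha * beta).
  by apply: mulr_ge0; lra.
move: lQ Pl lb h.
set q := l ^+ 3 * Q; set b := l `^ alpha * beta; set a := l ^+ 2 * A.
by move=> lQ Pl lb h; nra.
Qed.

End RealArithmetic.

Theorem lemma3p6 (R : realType) (alpha : R) (halpha1 : 1 < alpha)
    (halpha2 : alpha <= 2) (k : R) (hk : 0 < k) :
  ~ exists phi : H1 R,
      [/\ H1_neq0 phi,
          P_functional (inv_power k alpha) phi = 0%E &
          S_functional (inv_power k alpha) phi = constrained_inf (inv_power k alpha)].
Proof.
case=> phi [phi0 Pphi Sphi].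
have a0 : 0 < alpha by exact: lt_trans halpha1.
set V := inv_power k alpha in Pphi Sphi *.
have mphi := measurable_abs2 (H1fun_L2 phi).
have int_ge0 (f : R3 R -> R) : (forall x, 0 <= f x) ->
    (0 <= \int[leb3 R]_x (f x)%:E)%E.
  by move=> f0; apply: integral_ge0 => x _; rewrite lee_fin.
have fin (x : \bar R) : (0 <= x)%E -> (x < +oo)%E ->
    exists2 r, x = r%:E & 0 <= r.
  by case: x => [r| |]//; rewrite lee_fin => r0 _; exists r.
have [A AE A0] : exists2 r,
    (\int[leb3 R]_x (grad_abs2 phi x)%:E)%E = r%:E & 0 <= r.
  apply: fin; last exact: integral_grad_abs2_lty.
  by apply: int_ge0 => x; apply: sumr_ge0 => i _; exact: abs2_ge0.
have [M ME M0] : exists2 r,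
    (\int[leb3 R]_x (abs2 (phi x))%:E)%E = r%:E & 0 <= r.
  apply: fin; last exact: integral_abs2_lty (H1fun_L2 phi).
  by apply: int_ge0 => x; exact: abs2_ge0.
have pot0 b : (0 < \int[leb3 R]_x (V (x - b)%R * abs2 (phi x))%:E)%E.
  exact: int_pot_gt0.
have B0' : (0 < \int[leb3 R]_x (V x * abs2 (phi x))%:E)%E.
  by have := pot0 0; under eq_integral do rewrite subr0.
have Q0' : (0 <= \int[leb3 R]_x (Normc.normc (phi x) ^+ 4)%:E)%E.
  by apply: int_ge0 => x; rewrite normc4E sqr_ge0.
(* An infinite [B] or [Q] would make the left-hand side of the constraint
   infinite: [+oo - +oo] is [-oo] in the extended reals. *)
have [B [Q [BE QE B0 PE]]] : exists B Q,
    [/\ (\int[leb3 R]_x (V x * abs2 (phi x))%:E = B%:E)%E,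
        (\int[leb3 R]_x (Normc.normc (phi x) ^+ 4)%:E = Q%:E)%E,
        0 < B & 2 * A + alpha * B = 3 / 2 * Q].
  move: Pphi; rewrite P_functional_inv_power// AE.
  move: B0' Q0'; case: (\int[leb3 R]_x (V x * _)%:E)%E => [B| |]//;
    case: (\int[leb3 R]_x (_ ^+ 4)%:E)%E => [Q| |]// B0 Q0.
  - move=> [] /eqP; rewrite subr_eq0 => /eqP PE.
    by exists B, Q; split => //; rewrite -lte_fin.
  - by rewrite gt0_muley// lte_fin.
  - by rewrite gt0_muley// lte_fin.
  - by rewrite !gt0_muley// lte_fin.
have Q0 : 0 < Q.
  have : 0 < alpha * B by exact: mulr_gt0.
  by lra.
have [b bB] := @exists_small_translate _ k alpha hk a0 halpha2 _ mphi
  (fun x => abs2_ge0 _) (integral_abs2_lty (H1fun_L2 phi)) B B0.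
have [beta betaE beta0] : exists2 r,
    (\int[leb3 R]_x (V (x - b)%R * abs2 (phi x))%:E)%E = r%:E & 0 < r.
  move: (pot0 b) bB; rewrite -/V.
  by case: (\int[leb3 R]_x _)%E => [r| |]//; rewrite lte_fin => r0 _; exists r.
have betaB : beta < B by rewrite -lte_fin -betaE.
have [l [l0 l1 Pl]] : exists l, [/\ 0 < l, l < 1 &
    2 * (l ^+ 2 * A) + alpha * (l `^ alpha * beta) = 3 / 2 * (l ^+ 3 * Q)].
  apply: scaling_root => //.
  by rewrite -PE ltrD2l ltr_pM2l.
(* The amplitude that preserves the mass. *)
pose c := Num.sqrt (l ^+ 3).
have l30 : 0 < l ^+ 3 by rewrite exprn_gt0.
have c0 : 0 < c by rewrite sqrtr_gt0.
have c2 : c ^+ 2 = l ^+ 3 by rewrite sqr_sqrtr// ltW.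
have c4 : c ^+ 4 = l ^+ 3 * l ^+ 3 by rewrite -c2 -exprD.
pose psi := H1_rescale phi b l0 c0.
have psiM : (\int[leb3 R]_x (abs2 (psi x))%:E)%E = M%:E.
  by rewrite int_abs2_aff c2 divff ?gt_eqF// mul1e.
have psiA : (\int[leb3 R]_x (grad_abs2 psi x)%:E)%E = (l ^+ 2 * A)%:E.
  rewrite int_grad_aff AE -EFinM exprMn c2; congr (_%:E).
  by field; rewrite gt_eqF.
have psiQ : (\int[leb3 R]_x (Normc.normc (psi x) ^+ 4)%:E)%E = (l ^+ 3 * Q)%:E.
  rewrite int_normc4_aff QE -EFinM c4; congr (_%:E).
  by field; rewrite gt_eqF.
have psiB : (\int[leb3 R]_x (V x * abs2 (psi x))%:E)%E = (l `^ alpha * beta)%:E.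
  rewrite int_pot_aff betaE -EFinM c2; congr (_%:E).
  by field; rewrite gt_eqF.
have psi0 : H1_neq0 psi by apply/H1_neq0P; rewrite psiM -ME; apply/H1_neq0P.
have Ppsi : P_functional V psi = 0%E.
  rewrite P_functional_inv_power// psiA psiQ psiB.
  by apply: (congr1 EFin); apply/eqP; rewrite subr_eq0 Pl.
have : (constrained_inf V <= S_functional V psi)%E.
  by apply: ereal_inf_lbound; exists psi.
rewrite -Sphi /S_functional psiA psiQ psiB psiM AE QE BE ME.
rewrite leNgt => /negP; apply; rewrite lte_fin.
exact: energy_decrease Pl.
Qed.
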